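(* Let $X$ be a real random variable with finite moments of any order, and let $Z\sim N(0,1)$. If the series $$\sum_{k=1}^\infty\frac{1}{k!}\,\big(\mathbb{E}H_k(X)\big)^2$$ is convergent, then $X$ has an absolutely continuous distribution with finite distance $\chi^2(X,Z)$.
   Context: $H_k(x)=(-1)^k(e^{-x^2/2})^{(k)}e^{x^2/2}$ is the $k$-th Chebyshev–Hermite polynomial. With $\varphi(x)=\frac{1}{\sqrt{2\pi}}e^{-x^2/2}$, for $X$ with density $p$, $\chi^2(X,Z)=\int_{-\infty}^\infty\frac{p(x)^2}{\varphi(x)}\,dx-1\in[0,\infty]$. *)

(* Defs.v *)
From HB Require Import structures.
From mathcomp Require Import all_boot all_order all_algebra.
From mathcomp Require Import all_classical all_reals all_analysis.
Import Order.TTheory GRing.Theory Num.Theory.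
Import numFieldNormedType.Exports.

Set Implicit Arguments.
Unset Strict Implicit.
Unset Printing Implicit Defensive.

Local Open Scope classical_set_scope.
Local Open Scope ring_scope.

(* Probabilists' normalization: hermite 1 x = x, hermite 2 x = x ^+ 2 - 1. *)
Definition hermite (R : realType) (k : nat) (x : R) : R :=
  (-1) ^+ k * derive1n k (fun t : R => expR (- (t ^+ 2) / 2)) x * expR (x ^+ 2 / 2).

Definition is_density d (T : measurableType d) (R : realType)
    (P : probability T R) (X : {RV P >-> R}) (p : R -> R) : Prop :=
  [/\ measurable_fun setT p,
      forall x, 0 <= p x &
      forall A : set R, measurable A ->
        distribution P X A = (\int[lebesgue_measure]_(x in A) (p x)%:E)%E].

(* chi^2(X, Z) for X with density p and Z standard normal; Z enters only
   through its density phi = normal_pdf 0 1. *)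
Definition chi2_normal (R : realType) (p : R -> R) : \bar R :=
  (\int[lebesgue_measure]_x (p x ^+ 2 / normal_pdf 0 1 x)%:E - 1)%E.

(* Main.v *)
(** Let gamma be the standard Gaussian law. By orthogonality of the Hermite
    polynomials, convergence of the series means that the functional
    q |-> E q(X) on polynomials satisfies (E q(X))^2 <= C * int q^2 dgamma.
    Applied to monomials, this bounds the moments of X so well that the Taylor
    polynomials of x |-> cos (a x + b) converge in L^2(law of X + gamma).
    Trigonometric polynomials, and then their bounded pointwise limits
    (indicators of rays, of Borel sets, simple functions) are therefore
    L^2-limits of polynomials, and inherit the inequality up to a factor 4.
    Applied to indicators it gives absolute continuity; applied to simple
    functions increasing to p / phi, where p is the Radon-Nikodym density, it
    bounds int p^2 / phi. *)
Require Import Defs.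
From HB Require Import structures.
From mathcomp Require Import all_boot all_order all_algebra.
From mathcomp Require Import ring lra zify.
From mathcomp Require Import all_classical all_reals all_analysis.
From mathcomp Require Import measurable_realfun.
Import Order.TTheory GRing.Theory Num.Theory.
Import numFieldNormedType.Exports.

Set Implicit Arguments.
Unset Strict Implicit.
Unset Printing Implicit Defensive.

Local Open Scope classical_set_scope.
Local Open Scope ring_scope.

Import HBNNSimple.

(** * Hermite polynomials and the Gaussian functional *)

(** The recurrence replaces derivatives of the exponential, so that orthogonality becomes pure
    algebra; [hermite_polyE] links it to [hermite]. *)
Fixpoint hermite_poly (R : nzRingType) (k : nat) : {poly R} :=
  if k is k'.+1 then 'X * hermite_poly R k' - (hermite_poly R k')^`() else 1.

Lemma hermite_polyS (R : nzRingType) k :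
  hermite_poly R k.+1 = 'X * hermite_poly R k - (hermite_poly R k)^`().
Proof. by []. Qed.

Lemma size_monic_hermite_poly (R : idomainType) k :
  size (hermite_poly R k) = k.+1 /\ hermite_poly R k \is monic.
Proof.
elim: k => [|k [szk mk]]; first by rewrite size_poly1 monic1.
have szX : size ('X * hermite_poly R k) = k.+2.
  by rewrite mulrC size_mulX ?monic_neq0// szk.
have szd : (size (- (hermite_poly R k)^`()) < size ('X * hermite_poly R k)%R)%N.
  by rewrite size_polyN szX (leq_ltn_trans (size_poly _ _))// szk.
split; first by rewrite hermite_polyS size_polyDl// szX.
by rewrite monicE hermite_polyS lead_coefDl// lead_coefM lead_coefX mul1r.
Qed.

(** [L] stands for expectation under the Gaussian law, and [LX] is Gaussian integration by parts;
    with [L1] it determines all moments. *)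
Section gaussian_functional.
Variables (R : realFieldType) (L : {linear {poly R} -> R | *%R}).
Local Notation H := (hermite_poly R).
Hypotheses (L1 : L 1 = 1) (LX : forall p, L ('X * p) = L p^`()).
Hypothesis L_ge0 : forall p, 0 <= L (p ^+ 2).

(** By [LX], the term ['X * H k * q] becomes the derivative of [H k * q]; the recurrence cancels the
    part where [H k] is differentiated, so each step moves one derivative onto [q]. *)
Lemma functional_hermite k q : L (H k * q) = L q^`(k).
Proof.
elim: k q => [|k IH] q; first by rewrite mul1r.
rewrite hermite_polyS mulrBl linearB /= -mulrA LX derivM linearD /=.
by rewrite addrAC subrr add0r IH -derivSn.
Qed.

Lemma functional_derivn_hermite j k : (j <= k)%N ->
  L (H j)^`(k) = if j == k then k`!%:R else 0.
Proof.
have [szj mj] := size_monic_hermite_poly R j.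
rewrite leq_eqVlt => /predU1P[<-|jk].
  rewrite eqxx; suff -> : (H j)^`(j) = j`!%:R *: 1.
    by rewrite linearZ /= L1 mulr1.
  apply/polyP => i; rewrite coef_derivn coefZ coef1.
  case: i => [|i]; last by rewrite nth_default ?mul0rn ?mulr0// szj addnS ltnS leq_addr.
  by rewrite addn0 ffactnn mulr1; move: mj; rewrite monicE lead_coefE szj /= => /eqP->.
rewrite ltn_eqF// (_ : _^`(k) = 0) ?linear0//.
apply/polyP => i; rewrite coef_derivn coef0 nth_default ?mul0rn// szj.
by rewrite (leq_trans jk)// leq_addr.
Qed.

Lemma functional_hermite_orthogonal j k :
  L (H k * H j) = if j == k then k`!%:R else 0.
Proof.
wlog jk : j k / (j <= k)%N => [wl|].
  by have /orP[/wl//|/wl] := leq_total j k; rewrite mulrC eq_sym => ->;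
    case: eqP => [->|].
by rewrite functional_hermite functional_derivn_hermite.
Qed.

Lemma functional_cauchy_schwarz p q : L (p * q) ^+ 2 <= L (p ^+ 2) * L (q ^+ 2).
Proof.
set A := L (p ^+ 2); set B := L (p * q); set D := L (q ^+ 2).
have quad s t : 0 <= s ^+ 2 * A + 2 * s * t * B + t ^+ 2 * D.
  have -> : s ^+ 2 * A + 2 * s * t * B + t ^+ 2 * D = L ((s *: p + t *: q) ^+ 2).
    rewrite -!linearZ -!linearD; congr (L _).
    rewrite -!mul_polyC !expr2 !polyCM; ring.
  exact: L_ge0.
have A0 : 0 <= A := L_ge0 p.
have [D0|D0] := eqVneq D 0.
  have [->|B0] := eqVneq B 0; first by rewrite expr0n mulr_ge0 ?L_ge0.
  (* With [D = 0] the form is affine in [t]; this [t] gives it the negative value [- A - 2]. *)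
  have := quad 1 (- (A + 1) / B).
  by rewrite D0 mulr1 -mulrA divfK// => quad1; lra.
have Dp : 0 < D by rewrite lt_neqAle eq_sym D0 L_ge0.
have := quad D (- B).
have -> : D ^+ 2 * A + 2 * D * - B * B + (- B) ^+ 2 * D = D * (A * D - B ^+ 2) by ring.
by rewrite pmulr_rge0// subr_ge0.
Qed.

(* Against polynomials of degree below n, M is represented by the truncated
   Hermite expansion [Q] of the density of M with respect to L. *)
Lemma functional_bound (M : {linear {poly R} -> R | *%R}) (C : R) :
  (forall n, \sum_(k < n) (k`!%:R)^-1 * M (H k) ^+ 2 <= C) ->
  forall q, M q ^+ 2 <= C * L (q ^+ 2).
Proof.
move=> MC q; pose n := size q.
pose Q := \sum_(k < n) ((k`!%:R)^-1 * M (H k)) *: H k.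
have QH j : (j < n)%N -> L (Q * H j) = M (H j).
  move=> jn; rewrite /Q mulr_suml linear_sum /= (bigD1 (Ordinal jn)) //=.
  rewrite -scalerAl linearZ /= functional_hermite_orthogonal eqxx big1 => [|i ij].
    by rewrite addr0 mulrAC mulVf ?mul1r// pnatr_eq0 -lt0n fact_gt0.
  rewrite -scalerAl linearZ /= functional_hermite_orthogonal ifF ?mulr0//.
  by apply/negbTE; rewrite eq_sym.
(* [H m] is monic of degree [m], so subtracting its multiple by the top coefficient of [r] lowers
   the size. *)
have Qrep m (r : {poly R}) : (m <= n)%N -> (size r <= m)%N -> L (Q * r) = M r.
  elim: m r => [|m IH] r mn.
    by rewrite size_poly_leq0 => /eqP->; rewrite mulr0 !linear0.
  move=> rm; have [szm mm] := size_monic_hermite_poly R m.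
  rewrite -(subrK (r`_m *: H m) r) mulrDr [LHS]linearD [RHS]linearD /=.
  rewrite -scalerAr [X in _ + X]linearZ /= QH//.
  congr (_ + _); last by rewrite linearZ.
  apply: IH; first exact: ltnW.
  apply/leq_sizeP => j; rewrite leq_eqVlt coefB coefZ => /predU1P[<-|mj].
    by move: mm; rewrite monicE lead_coefE szm /= => /eqP->; rewrite mulr1 subrr.
  rewrite [r`_j]nth_default ?(leq_trans rm)//.
    by rewrite [X in _ * X]nth_default ?szm// mulr0 subr0.
(* Expanding one factor [Q] and using [QH] on the other gives exactly the truncated series. *)
have LQ : L (Q ^+ 2) <= C.
  apply: le_trans (MC n); rewrite expr2 {2}/Q mulr_sumr linear_sum /= ler_sum// => k _.
  by rewrite -scalerAr linearZ /= QH// -mulrA -expr2.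
rewrite -(Qrep n)// (le_trans (functional_cauchy_schwarz _ _))//.
by rewrite ler_wpM2r.
Qed.

Lemma functional_moment_SS n : L 'X^(n.+2) = n.+1%:R * L 'X^n.
Proof. by rewrite exprS LX derivXn linearMn /= mulr_natl. Qed.

Lemma functional_even_moment n : 0 <= L 'X^(2 * n) <= 4 ^+ n * n`!%:R.
Proof.
elim: n => [|n /andP[IH0 IH]].
  by rewrite muln0 !expr0 L1 fact0 mulr1 ler01 lexx.
rewrite mulnS functional_moment_SS mulr_ge0//=.
rewrite exprS factS natrM mulrACA ler_pM// -natrM ler_nat.
by rewrite -addn1 mulnS; lia.
Qed.

(** The recursion factor is [(4n+3)(4n+1)], at most [(4(n+1))^2]. The bound is a perfect square
    because [M 'X^(2 * n)] will be controlled through its square. *)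
Lemma functional_moment_mul4 n : L 'X^(4 * n) <= (4 ^+ n * n`!%:R) ^+ 2.
Proof.
elim: n => [|n IH]; first by rewrite muln0 !expr0 L1 fact0 mulr1 expr1n.
have := functional_even_moment (2 * n); rewrite mulnA => /andP[m0 _].
rewrite mulnS !functional_moment_SS mulrA.
have -> : (4 ^+ n.+1 * (n.+1)`!%:R) ^+ 2 =
    (4 * n.+1%:R) ^+ 2 * (4 ^+ n * n`!%:R) ^+ 2 :> R.
  by rewrite (exprS 4) factS natrM; ring.
apply: ler_pM; [by rewrite mulr_ge0|exact: m0| |exact: IH].
by rewrite -!natrM -natrX ler_nat; nia.
Qed.

End gaussian_functional.

Lemma hermite_polyE (R : realType) k (x : R) : hermite k x = (hermite_poly R k).[x].
Proof.
have der (p : {poly R}) : derive1 (fun t : R => p.[t] * expR (- (t ^+ 2) / 2)) =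
    (fun t => - ('X * p - p^`()).[t] * expR (- (t ^+ 2) / 2)).
  apply/funext => t; rewrite derive1E; apply: derive_val.
  apply: is_derive_eq; rewrite !hornerE /= /GRing.scale /=.
  by field.
have iterE : derive1n k (fun t : R => expR (- (t ^+ 2) / 2)) =
    (fun t => (-1) ^+ k * (hermite_poly R k).[t] * expR (- (t ^+ 2) / 2)).
  elim: k => [|k IH]; first by apply/funext => t; rewrite /= !hornerE.
  rewrite derive1nS IH; have := der ((-1) ^+ k *: hermite_poly R k).
  under eq_fun do rewrite hornerZ; move=> ->; apply/funext => t.
  rewrite hermite_polyS derivZ !hornerE /= [(-1) ^+ _.+1]exprS; ring.
rewrite /hermite iterE mulrA mulrA -expr2 sqrr_sign mul1r -mulrA -expRD.
by rewrite mulNr addNr expR0 mulr1.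
Qed.

(** * Taylor expansion of the cosine *)

(** Here [f j] is the [j]-th derivative of [f 0]. The remainder of order [n.+1] has as derivative
    the remainder of order [n] for the shifted sequence, which the induction bounds. *)
Lemma taylor_remainder_ge0 (R : realType) (f : nat -> R -> R) :
  (forall j (x : R), is_derive x (1 : R) (f j) (f j.+1 x)) ->
  (forall j x, `|f j x| <= 1) ->
  forall n (x : R), 0 <= x ->
  `|f 0 x - \sum_(k < n) f k 0 / k`!%:R * x ^+ k| <= x ^+ n / n`!%:R.
Proof.
move=> df f1 n; elim: n f df f1 => [|n IH] f df f1 x x0.
  by rewrite big_ord0 subr0 fact0 divr1 expr0.
pose q : {poly R} := \sum_(k < n.+1) (f k 0 / k`!%:R) *: 'X^k.
have qE y : \sum_(k < n.+1) f k 0 / k`!%:R * y ^+ k = q.[y].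
  by rewrite horner_sum; apply: eq_bigr => k _; rewrite !hornerE.
have dqE y : \sum_(k < n) f k.+1 0 / k`!%:R * y ^+ k = q^`().[y].
  rewrite raddf_sum /= horner_sum big_ord_recl/= derivZ derivXn scaler0 horner0 add0r.
  apply: eq_bigr => k _; rewrite derivZ derivXn /= !hornerE factS natrM hornerMn hornerXn.
  by rewrite /bump /= add1n -[_ *+ _]mulr_natl; field;
    rewrite nat1r !pnatr_eq0 -lt0n fact_gt0.
pose r (s : R) : {poly R} := (n.+1`!%:R)^-1 *: 'X^(n.+1) + s *: q.
(* Bound minus [s] times the remainder: it vanishes at 0 and is nondecreasing for [s = 1] and
   [s = -1], which gives both sides of the absolute value. *)
pose g s := horner (r s) - cst s * f 0%N.
have gE s y : g s y = y ^+ n.+1 / n.+1`!%:R - s * (f 0 y - q.[y]).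
  rewrite /g /r !fctE !hornerE; ring.
have g0 s : g s 0 = 0.
  rewrite gE -qE big_ord_recl /= big1 => [|j _]; last by rewrite expr0n mulr0.
  by rewrite expr0n /= mul0r expr0 fact0; field.
have dg s y : is_derive y (1 : R) (g s) (y ^+ n / n`!%:R - s * (f 1 y - q^`().[y])).
  have df0 := df 0%N y.
  apply: is_derive_eq; rewrite /r derivD !derivZ derivXn !hornerE factS natrM.
  rewrite hornerMn hornerXn /GRing.scale /= -[_ *+ _]mulr_natl; field.
  by rewrite nat1r !pnatr_eq0 -lt0n fact_gt0.
have g_ge0 s : `|s| = 1 -> 0 <= g s x.
  move=> s1; rewrite -(g0 s).
  apply: (@ger0_derive1_ndecr _ (g s) 0 x) => //.
  - move=> y /itvP yx; rewrite derive1E (@derive_val _ _ _ _ _ _ _ (dg s y)) subr_ge0.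
    rewrite (le_trans (ler_norm _))// normrM s1 mul1r -dqE.
    by apply: (IH (fun j => f j.+1)) => //; rewrite yx.
  - by apply: derivable_within_continuous => y _.
have := g_ge0 1 (normr1 _); have := g_ge0 (-1) (normrN1 _).
by rewrite !gE qE ler_norml => ? ?; apply/andP; split; lra.
Qed.

Lemma taylor_remainder (R : realType) (f : nat -> R -> R) :
  (forall j (x : R), is_derive x (1 : R) (f j) (f j.+1 x)) ->
  (forall j x, `|f j x| <= 1) ->
  forall n (x : R),
  `|f 0 x - \sum_(k < n) f k 0 / k`!%:R * x ^+ k| <= `|x| ^+ n / n`!%:R.
Proof.
move=> df f1 n x; have [x0|x0] := leP 0 x.
  by rewrite [in leRHS]ger0_norm//; exact: taylor_remainder_ge0.
pose g j (y : R) := (-1) ^+ j * f j (- y).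
have dg j (y : R) : is_derive y (1 : R) (g j) (g j.+1 y).
  have dfy := df j (- y).
  have dN : is_derive y (1 : R) (fun z : R => - z) (-1) by apply: is_derive_eq.
  have dc : is_derive y (1 : R) (f j \o (fun z : R => - z)) _ := is_derive1_comp dfy dN.
  rewrite (_ : g j = cst ((-1) ^+ j) * (f j \o (fun z : R => - z)))//.
  apply: is_derive_eq; rewrite /g exprS.
  rewrite /GRing.scale /= mulr0 addr0; ring.
have g1 j (y : R) : `|g j y| <= 1 by rewrite /g normrM normrX normrN1 expr1n mul1r.
have := taylor_remainder_ge0 dg g1 n (x := - x).
rewrite oppr_ge0 (ltW x0) (ltr0_norm x0) => /(_ isT); rewrite {1}/g expr0 mul1r opprK.
congr (`|_ - _| <= _); apply: eq_bigr => k _.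
rewrite /g oppr0 (exprNn x) -[RHS]mul1r -[X in _ = X * _](sqrr_sign R k).
by move: ((-1) ^+ k) => s; ring.
Qed.

(** Each derivative of the cosine is a phase shift by [pi / 2], so all derivatives have one form and
    are bounded by 1. *)
Lemma cos_taylor (R : realType) (b y : R) n :
  `|cos (y + b) - \sum_(k < n) cos (b + k%:R * (pi / 2)) / k`!%:R * y ^+ k| <=
  `|y| ^+ n / n`!%:R.
Proof.
pose f j (z : R) := cos (z + (b + j%:R * (pi / 2))).
have df j (z : R) : is_derive z (1 : R) (f j) (f j.+1 z).
  have dA : is_derive z (1 : R) (id + cst (b + j%:R * (pi / 2))) (1 + 0).
    exact: is_deriveD.
  have dc := is_derive1_comp (is_derive_cos _) dA.
  apply: (is_derive_eq (df := _) dc).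
  rewrite addr0 mulr1 /f -(natr1 j) (mulrDl j%:R) mul1r !addrA cosDpihalf.
  by rewrite !fctE /= ?addrA.
have f1 j (z : R) : `|f j z| <= 1 by rewrite ler_norml cos_geN1 cos_le1.
have := taylor_remainder df f1 n y; rewrite /f mul0r addr0.
by under eq_bigr do rewrite add0r.
Qed.

(** * Approximation by polynomials in mean square *)

Section square_integral.
Context d (T : measurableType d) (R : realType).
Variable nu : {measure set T -> \bar R}.
Implicit Types f g : T -> R.

Definition sqint f := (\int[nu]_x ((f x) ^+ 2)%:E)%E.

Lemma measurable_sqr_EFin f : measurable_fun [set: T] f ->
  measurable_fun [set: T] (fun x => ((f x) ^+ 2)%:E).
Proof. by move=> mf; apply/measurable_EFinP; exact: measurable_funX. Qed.

Lemma sqint_ge0 f : (0 <= sqint f)%E.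
Proof. by apply: integral_ge0 => x _; rewrite lee_fin sqr_ge0. Qed.

Lemma sqintZ (c : R) f : measurable_fun [set: T] f ->
  sqint (fun x => c * f x) = ((c ^+ 2)%:E * sqint f)%E.
Proof.
move=> mf; rewrite /sqint; under eq_integral do rewrite exprMn EFinM.
apply: ge0_integralZl => //; first exact: measurable_sqr_EFin.
- by move=> x _; rewrite lee_fin sqr_ge0.
- by rewrite lee_fin sqr_ge0.
Qed.

(** From [2f^2 + 2g^2 - (f+g)^2 = (f-g)^2]. It stands in for Minkowski's inequality without square
    roots. *)
Lemma sqintD f g : measurable_fun [set: T] f -> measurable_fun [set: T] g ->
  (sqint (fun x => f x + g x)%R <= 2%:E * sqint f + 2%:E * sqint g)%E.
Proof.
move=> mf mg; have f0 (h : T -> R) x : [set: T] x -> (0 <= ((h x) ^+ 2)%:E)%E.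
  by rewrite lee_fin sqr_ge0.
have mf2 := measurable_sqr_EFin mf; have mg2 := measurable_sqr_EFin mg.
have two0 : (0 <= 2%:E :> \bar R)%E by [].
rewrite -(ge0_integralZl nu measurableT mf2 (f0 f) two0).
rewrite -(ge0_integralZl nu measurableT mg2 (f0 g) two0).
rewrite -ge0_integralD//; last 4 first.
- by move=> x _; rewrite -EFinM lee_fin mulr_ge0// sqr_ge0.
- exact: measurable_funeM.
- by move=> x _; rewrite -EFinM lee_fin mulr_ge0// sqr_ge0.
- exact: measurable_funeM.
apply: ge0_le_integral => //.
- by move=> x; exact: (f0 (fun x => f x + g x)%R).
- by apply: measurable_sqr_EFin; exact: measurable_funD.
- by apply: emeasurable_funD; exact: measurable_funeM.
- by move=> x _; rewrite -!EFinM -EFinD lee_fin; have := sqr_ge0 (f x - g x); nra.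
Qed.

End square_integral.

Section poly_approx.
Context {R : realType}.
Variable nu : {finite_measure set (measurableTypeR R) -> \bar R}.
Local Notation sqint := (sqint nu).
Implicit Types (f g : measurableTypeR R -> R) (q : {poly R}).

(** Membership in the closure of the polynomials for the L^2(nu) distance. *)
Definition poly_approximable f := measurable_fun setT f /\
  forall e : R, 0 < e -> exists q, (sqint (fun x => f x - q.[x])%R <= e%:E)%E.

Let measurable_horner q : measurable_fun setT (fun x : measurableTypeR R => q.[x]).
Proof. exact: measurable_poly. Qed.

Lemma poly_approximable_closed f : measurable_fun setT f ->
  (forall e : R, 0 < e ->
    exists2 g, poly_approximable g & (sqint (fun x => f x - g x)%R <= e%:E)%E) ->
  poly_approximable f.
Proof.
move=> mf fg; split=> // e e0; have e4 : 0 < e / 4 by rewrite divr_gt0.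
have [g [mg /(_ _ e4)[q gq]] fge] := fg _ e4; exists q.
have /= := @sqintD _ _ _ nu (fun x => f x - g x) (fun x => g x - q.[x]).
rewrite (_ : (fun x => f x - g x + (g x - q.[x])) = fun x => f x - q.[x]); last first.
  by apply/funext => x; rewrite addrA subrK.
have mq := measurable_horner q.
move=> /(_ (measurable_funB mf mg) (measurable_funB mg mq))/le_trans; apply.
have -> : e%:E = (2%:E * (e / 4)%:E + 2%:E * (e / 4)%:E)%E.
  by rewrite -!EFinM -EFinD; congr EFin; field.
by rewrite leeD// lee_wpmul2l.
Qed.

Lemma poly_approximableD f g : poly_approximable f -> poly_approximable g ->
  poly_approximable (fun x => f x + g x).
Proof.
move=> [mf fa] [mg ga]; split=> [|e e0]; first exact: measurable_funD.
have e4 : 0 < e / 4 by rewrite divr_gt0.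
have [p fp] := fa _ e4; have [q gq] := ga _ e4; exists (p + q).
have mp := measurable_horner p.
have mq := measurable_horner q.
have /= := @sqintD _ _ _ nu (fun x => f x - p.[x]) (fun x => g x - q.[x]).
rewrite (_ : (fun x => f x - p.[x] + (g x - q.[x])) =
             fun x => f x + g x - (p + q).[x]); last first.
  by apply/funext => x; rewrite hornerD addrACA opprD.
move=> /(_ (measurable_funB mf mp) (measurable_funB mg mq))/le_trans; apply.
have -> : e%:E = (2%:E * (e / 4)%:E + 2%:E * (e / 4)%:E)%E.
  by rewrite -!EFinM -EFinD; congr EFin; field.
by rewrite leeD// lee_wpmul2l.
Qed.

Lemma poly_approximableZ (c : R) f : poly_approximable f ->
  poly_approximable (fun x => c * f x).
Proof.
move=> [mf fa]; split=> [|e e0]; first exact: measurable_funM.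
(* The added 1 keeps the divisor positive when [c = 0]. *)
have c0 : 0 < c ^+ 2 + 1 by rewrite ltr_wpDl// sqr_ge0.
have [q fq] := fa (e / (c ^+ 2 + 1)) (divr_gt0 e0 c0); exists (c *: q).
have mq := measurable_horner q.
under eq_fun do rewrite hornerZ -mulrBr.
rewrite sqintZ//; last exact: measurable_funB.
have c2 : (0 <= (c ^+ 2)%:E)%E by rewrite lee_fin sqr_ge0.
apply: le_trans (lee_wpmul2l c2 fq) _.
by rewrite -EFinM lee_fin mulrCA ler_piMr ?(ltW e0)// ler_pdivrMr// mul1r lerDl.
Qed.

Lemma poly_approximable_poly q : poly_approximable (fun x => q.[x]).
Proof.
split=> [|e e0]; first exact: measurable_poly.
exists q; under eq_fun do rewrite subrr.
by rewrite /sqint; under eq_integral do rewrite expr0n; rewrite integral0 lee_fin ltW.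
Qed.

Lemma poly_approximable_cst (c : R) : poly_approximable (fun=> c).
Proof. by have := poly_approximable_poly c%:P; under eq_fun do rewrite hornerC. Qed.

Lemma poly_approximable_sum (I : Type) (r : seq I) (f : I -> R -> R) :
  (forall i, poly_approximable (f i)) -> poly_approximable (fun x => \sum_(i <- r) f i x).
Proof.
move=> fa; elim: r => [|i r IH].
  by under eq_fun do rewrite big_nil; exact: poly_approximable_cst.
by under eq_fun do rewrite big_cons; exact: poly_approximableD.
Qed.

(** Dominated convergence: the differences are bounded by 2, their squares by 4, and constants are
    integrable since [nu] is finite. *)
Lemma poly_approximable_lim (g : nat -> R -> R) f :
  (forall n, poly_approximable (g n)) -> (forall n x, `|g n x| <= 1) ->
  (forall x, g ^~ x @ \oo --> f x) -> poly_approximable f.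
Proof.
move=> ga g1 gf.
have mf : measurable_fun setT f.
  by apply: (@measurable_fun_cvg _ _ _ _ g) => // n; case: (ga n).
have f1 x : `|f x| <= 1.
  by apply: (cvgr_to_le (cvg_norm (gf x))); apply: nearW => n.
apply: poly_approximable_closed => // e e0.
have mfg n : measurable_fun setT (fun x => f x - g n x).
  by apply: measurable_funB => //; case: (ga n).
have cvg0 x : (fun n => ((f x - g n x) ^+ 2)%:E) @ \oo --> 0%E.
  apply: cvg_EFin; first exact: nearW.
  have -> : 0 = (f x - f x) ^+ 2 by rewrite subrr expr0n.
  have fg : (fun n => f x - g n x) @ \oo --> f x - f x.
    by apply: cvgB; [exact: cvg_cst|exact: gf].
  by rewrite [X in X @ _ --> _](_ : _ = fun n => (f x - g n x) * (f x - g n x));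
    [exact: (cvgM fg fg)|apply/funext => n].
have dom x n : (`|((f x - g n x) ^+ 2)%:E| <= 4%:E)%E.
  rewrite abse_EFin lee_fin normrX (_ : 4 = 2 ^+ 2); last by rewrite -natrX.
  by rewrite lerXn2r ?nnegrE// (le_trans (ler_normB _ _))// -[2]/(1 + 1) lerD.
have [_ _] : [/\ nu.-integrable setT (cst 0%E),
    (\int[nu]_x `|((f x - g n x) ^+ 2)%:E - 0|)%E @[n --> \oo] --> 0%E &
    sqint (fun x => f x - g n x) @[n --> \oo] --> (\int[nu]_(x in setT) 0)%E].
  apply: (@dominated_convergence _ _ _ nu setT measurableT _ _ (cst 4%:E)) => //.
  - by move=> n; apply: measurable_sqr_EFin.
  - by apply: aeW => x _; exact: cvg0.
  - exact: finite_measure_integrable_cst.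
  - by apply: aeW => x n _; exact: dom.
rewrite integral0 => icvg0.
have : \forall n \near \oo, (sqint (fun x => (f x - g n x)%R) < e%:E)%E.
  have e0E : (0 < e%:E :> \bar R)%E by rewrite lte_fin.
  exact: (icvg0 _ (open_ereal_lt' e0E)).
case=> N _ /(_ N (leqnn N)) /= gN.
exists (g N) => //; exact: ltW.
Qed.

End poly_approx.

(** * Trigonometric polynomials and their pointwise limits *)

Inductive trig_poly (R : realType) : (R -> R) -> Prop :=
| trig_poly_cos a b c : trig_poly (fun x => c * cos (a * x + b))
| trig_poly_add f g : trig_poly f -> trig_poly g -> trig_poly (fun x => f x + g x).

Section trig_poly.
Context {R : realType}.
Implicit Types f g : R -> R.

Lemma trig_poly_cst (c : R) : trig_poly (fun=> c).
Proof.
rewrite (_ : (fun=> c) = fun x => c * cos (0 * x + 0)); first exact: trig_poly_cos.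
by apply/funext => x; rewrite mul0r addr0 cos0 mulr1.
Qed.

(** Product-to-sum formula. The free phase in the generators lets cosines alone cover sines and, at
    frequency 0, constants. *)
Lemma trig_polyM f g : trig_poly f -> trig_poly g -> trig_poly (fun x => f x * g x).
Proof.
move=> tf tg; elim: tf => {f} [a b c|f1 f2 _ IH1 _ IH2]; last first.
  by under eq_fun do rewrite mulrDl; exact: trig_poly_add.
elim: tg => {g} [a' b' c'|g1 g2 _ IH1 _ IH2]; last first.
  by under eq_fun do rewrite mulrDr; exact: trig_poly_add.
rewrite (_ : (fun x => _) = (fun x => c * c' / 2 * cos ((a - a') * x + (b - b')) +
    c * c' / 2 * cos ((a + a') * x + (b + b')))).
  by apply: trig_poly_add; exact: trig_poly_cos.
apply/funext => x.
have -> : (a - a') * x + (b - b') = (a * x + b) - (a' * x + b') by ring.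
have -> : (a + a') * x + (b + b') = (a * x + b) + (a' * x + b') by ring.
by move: (a * x + b) (a' * x + b') => y z; rewrite cosB cosD; field.
Qed.

Lemma trig_polyX f n : trig_poly f -> trig_poly (fun x => f x ^+ n).
Proof.
move=> tf; elim: n => [|n IH]; first exact: trig_poly_cst.
by under eq_fun do rewrite exprS; exact: trig_polyM.
Qed.

(** The Taylor polynomial of [cos (a * x + b)] in powers of [a * x] errs by at most the monomial in
    the hypothesis, by [cos_taylor]. *)
Lemma trig_poly_approximable (nu : {finite_measure set (measurableTypeR R) -> \bar R}) :
  (forall a e : R, 0 < e -> exists N,
    (sqint nu (fun x => (a * x) ^+ N / N`!%:R)%R <= e%:E)%E) ->
  forall f, trig_poly f -> poly_approximable nu f.
Proof.
move=> rem f; elim=> {f} [a b c|f g _ af _ ag]; last exact: poly_approximableD.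
apply: poly_approximableZ.
have mcosR : measurable_fun [set: R] (fun x : R => cos (a * x + b)).
  apply: measurableT_comp.
    by apply: continuous_measurable_fun; exact: continuous_cos.
  by apply: measurable_funD => //; exact: measurable_funM.
have mcos : measurable_fun (T := measurableTypeR R) setT (fun x => cos (a * x + b)).
  exact: mcosR.
split=> // e e0; have [N remN] := rem a e e0.
exists (\sum_(k < N) (cos (b + k%:R * (pi / 2)) / k`!%:R * a ^+ k) *: 'X^k).
apply: le_trans remN; apply: ge0_le_integral => //.
- by move=> x _; rewrite lee_fin sqr_ge0.
- by apply: measurable_sqr_EFin; apply: measurable_funB => //; exact: measurable_poly.
- apply: measurable_sqr_EFin; apply: measurable_funM => //.
  by apply: measurable_funX; exact: measurable_funM.
- move=> x _; rewrite lee_fin.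
  rewrite -[leLHS]real_normK ?num_real// -[leRHS]real_normK ?num_real//.
  rewrite lerXn2r ?nnegrE// normrM normrX [X in _ <= _ * X]ger0_norm ?invr_ge0//.
  apply: le_trans (cos_taylor b (a * x) N); rewrite horner_sum le_eqVlt.
  apply/orP; left; apply/eqP; congr (`|_ - _|); apply: eq_bigr => k _.
  by rewrite hornerZ hornerXn exprMn -[LHS]mulrA.
Qed.

(** Write [r = s ^+ 2]: one factor [s ^+ n] keeps [n%:R * s ^+ n] bounded, the other tends to 0. *)
Lemma cvg_natM_expr (r : R) : 0 <= r < 1 -> (fun n => n%:R * r ^+ n) @ \oo --> 0.
Proof.
move=> /andP[r0 r1]; pose s := Num.sqrt r.
have s0 : 0 <= s := sqrtr_ge0 r.
have rs : r = s ^+ 2 by rewrite sqr_sqrtr.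
have s1 : s < 1 by rewrite -sqrtr1 ltr_sqrt.
have bound n : n%:R * s ^+ n * (1 - s) <= 1 - s ^+ n.
  elim: n => [|n IH]; first by rewrite expr0 subrr !mul0r.
  have sn1 : s ^+ n.+1 <= 1 by rewrite exprn_ile1// ltW.
  have : 0 <= (1 - s) * (1 - s ^+ n.+1) by rewrite mulr_ge0 ?subr_ge0// ltW.
  have : s * (n%:R * s ^+ n * (1 - s)) <= s * (1 - s ^+ n) by rewrite ler_wpM2l.
  by rewrite -natr1 exprS; move: (s ^+ n) (n%:R) => z m; lra.
have cvgs : (fun n => (1 - s)^-1 * s ^+ n) @ \oo --> 0.
  rewrite -[X in _ --> X](mulr0 (1 - s)^-1); apply: cvgM; first exact: cvg_cst.
  by apply: cvg_expr; rewrite ger0_norm.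
apply: (squeeze_cvgr _ (cvg_cst 0) cvgs); apply: nearW => n.
rewrite mulr_ge0 ?exprn_ge0//= rs -exprM mulnC exprM expr2 mulrA ler_wpM2r ?exprn_ge0//.
rewrite -[leRHS]mul1r ler_pdivlMr ?subr_gt0// (le_trans (bound n))//.
by rewrite gerBl exprn_ge0.
Qed.

Lemma bernoulli_ineq (x : R) n : 0 <= 1 + x -> 1 + n%:R * x <= (1 + x) ^+ n.
Proof.
move=> x1; elim: n => [|n IH]; first by rewrite mul0r addr0 expr0.
rewrite exprS (le_trans _ (ler_wpM2l x1 IH))//.
have : 0 <= n%:R * x ^+ 2 by rewrite mulr_ge0// sqr_ge0.
by rewrite -natr1; move: (n%:R) => m; nra.
Qed.

(* The exponent [n * 2 ^ n] instead of the usual [2 ^ n] makes the limit at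
   [u = 1 / 2] equal to 0. *)
Lemma step_approx_cvg (u : R) : 0 <= u <= 1 ->
  (fun n => (1 - u ^+ n) ^+ (n * 2 ^ n)) @ \oo --> ((u < 2^-1)%R%:R : R).
Proof.
move=> /andP[u0 u1].
have un n : 0 <= u ^+ n <= 1 by rewrite exprn_ge0//= exprn_ile1.
have [u2|u2] := ltP u 2^-1.
  (* Bernoulli's inequality gives this lower bound, and [2 * u < 1]. *)
  have cvg1 : (fun n => 1 - n%:R * (2 * u) ^+ n) @ \oo --> (1 : R).
    rewrite -[X in _ --> X]subr0; apply: cvgB; first exact: cvg_cst.
    by apply: cvg_natM_expr; rewrite mulr_ge0//=; lra.
  rewrite -[X in _ --> X]/(1 : R).
  apply: (squeeze_cvgr _ cvg1 (cvg_cst (1 : R))); apply: nearW => n.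
  have /andP[a0 a1] := un n; apply/andP; split; last first.
    by rewrite exprn_ile1// ?subr_ge0// gerBl.
  have := @bernoulli_ineq (- u ^+ n) (n * 2 ^ n); rewrite subr_ge0 => /(_ a1).
  by rewrite natrM natrX exprMn mulrN mulrA.
have cvg0 : (fun n => n%:R^-1) @ \oo --> (0 : R).
  apply/gtr0_cvgV0; last exact: cvgr_idn.
  by near=> n; rewrite ltr0n; near: n; exact: nbhs_infty_gt.
apply: (squeeze_cvgr _ (cvg_cst 0) cvg0); near=> n.
have n0 : (0 < n)%N by near: n; exact: nbhs_infty_gt.
have /andP[a0 a1] := un n.
rewrite exprn_ge0 ?subr_ge0//= -[leRHS]mul1r ler_pdivlMr ?ltr0n//.
have a2 : 0 <= 1 + u ^+ n by lra.
(* By Bernoulli and [2 * u >= 1], the power of [1 + u ^+ n] is at least [n], while its product with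
   the power of [1 - u ^+ n] is at most 1. *)
apply: le_trans (_ : (1 - u ^+ n) ^+ (n * 2 ^ n) * (1 + u ^+ n) ^+ (n * 2 ^ n) <= _).
  apply: ler_wpM2l; first by rewrite exprn_ge0 ?subr_ge0.
  apply: le_trans (bernoulli_ineq _ a2); rewrite natrM -mulrA ler_wpDl//.
  rewrite ler_peMr// natrX -exprMn exprn_ege1//; lra.
rewrite -exprMn exprn_ile1//; first by rewrite mulr_ge0 ?subr_ge0.
by have := sqr_ge0 (u ^+ n); nra.
Unshelve. all: by end_near. Qed.

End trig_poly.

(** * From trigonometric polynomials to simple functions *)

Section measurable_approx.
Context {R : realType}.
Variable nu : {finite_measure set (measurableTypeR R) -> \bar R}.
Hypothesis trig_approx : forall f : R -> R, trig_poly f -> poly_approximable nu f.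

(** An affine map sends the sine into [0, 1] and the sign change to the threshold 1/2, where
    [step_approx_cvg] turns powers of trigonometric polynomials into an indicator. *)
Lemma sin_neg_approximable (a b : R) :
  poly_approximable nu (fun x => (sin (a * (x - b)) < 0)%R%:R).
Proof.
pose u x : R := 2^-1 + 2^-1 * cos (a * x + (- (a * b) - pi / 2)).
have uE x : u x = (1 + sin (a * (x - b))) / 2.
  by rewrite /u addrA cosBpihalf -mulrBr; field.
have u01 x : 0 <= u x <= 1.
  have := sin_geN1 (a * (x - b)); have := sin_le1 (a * (x - b)).
  by rewrite uE => ? ?; apply/andP; split; lra.
pose g n x := (1 - u x ^+ n) ^+ (n * 2 ^ n).
apply: (@poly_approximable_lim _ _ g) => [n|n x|x].
- apply: trig_approx; apply: trig_polyX.
  rewrite (_ : (fun x => _) = (fun x => 1 + (-1) * u x ^+ n)); last first.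
    by apply/funext => x; rewrite mulN1r.
  apply: trig_poly_add; first exact: trig_poly_cst.
  apply: trig_polyM; first exact: trig_poly_cst.
  apply: trig_polyX; apply: trig_poly_add; first exact: trig_poly_cst.
  exact: trig_poly_cos.
- have /andP[u0 u1] := u01 x.
  have un0 : 0 <= u x ^+ n by rewrite exprn_ge0.
  have un1 : u x ^+ n <= 1 by rewrite exprn_ile1.
  by rewrite /g ger0_norm ?exprn_ge0 ?exprn_ile1 ?subr_ge0// gerBl.
- have := step_approx_cvg (u01 x).
  suff -> : (u x < 2^-1) = (sin (a * (x - b)) < 0) by [].
  by rewrite uE; apply/idP/idP => ?; lra.
Qed.

(** At frequency [n.+1%:R^-1] the point [x] eventually falls within the half-period around [b] on
    its side, where the sine has the sign of [x - b]. *)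
Lemma ray_approximable (b : R) : poly_approximable nu (fun x => (x < b)%R%:R).
Proof.
apply: (poly_approximable_lim (fun n => sin_neg_approximable n.+1%:R^-1 b)) => [n x|x].
  by case: (_ < _); rewrite ?normr1 ?normr0.
apply: cvg_near_cst; near=> n; congr (_%:R); congr nat_of_bool.
have pi1 : 1 < pi :> R by have := pihalf_ge1 R; lra.
have n0 : 0 < n.+1%:R^-1 :> R by rewrite invr_gt0.
have ny : n.+1%:R^-1 * `|x - b| < 1.
  have nxb : `|x - b| < n%:R by near: n; exact: nbhs_infty_gtr.
  by rewrite mulrC ltr_pdivrMr// mul1r (lt_trans nxb)// ltr_nat.
have [xb|xb] := ltrP x b.
  rewrite -oppr_gt0 -sinN sin_gt0_pi// -mulrN opprB.
  move: ny; rewrite distrC gtr0_norm ?subr_gt0// => ny.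
  by rewrite mulr_gt0 ?subr_gt0//= (lt_trans ny).
apply/negbTE; rewrite -leNgt sin_ge0_pi//.
move: ny; rewrite ger0_norm ?subr_ge0// => ny.
by rewrite mulr_ge0 ?subr_ge0 ?(ltW n0)//= ltW// (lt_trans ny).
Unshelve. all: by end_near. Qed.

(** Dynkin's pi-lambda theorem from the open left rays. For disjoint unions the partial sums stay in
    {0, 1}, so the bounded limit lemma applies. *)
Lemma indic_approximable (A : set (measurableTypeR R)) :
  measurable A -> poly_approximable nu (\1_A : _ -> R).
Proof.
move=> mA; have : <<s @RGenInftyO.G R >> A.
  by have := RGenInftyO.measurableE R; rewrite /measurable /= => <-.
apply: (@dynkin_induction _ (measurableTypeR R) (@RGenInftyO.G R)
  (fun A => poly_approximable nu (\1_A : _ -> R))).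
- exact: RGenInftyO.measurableE.
- move=> _ _ [x ->] [y ->]; exists (Num.min x y).
  by apply/seteqP; split=> z /=; rewrite !in_itv/= lt_min => /andP.
- by rewrite indicT; exact: poly_approximable_cst.
- move=> _ [x ->]; rewrite (_ : \1__ = fun y : R => (y < x)%R%:R).
    exact: ray_approximable.
  apply/funext => y; rewrite indicE; congr (nat_of_bool _)%:R.
  by apply/idP/idP; rewrite inE /= in_itv.
- move=> B _ aB; rewrite (_ : \1__ = fun y : R => 1 + (-1) * \1_B y); last first.
    by apply/funext => y; rewrite !indicE in_setC; case: (y \in B) => /=; lra.
  apply: poly_approximableD; first exact: poly_approximable_cst.
  exact: poly_approximableZ.
- move=> F mF tF aF; pose S n (x : R) : R := \sum_(k <- iota 0 n) \1_(F k) x.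
  have S0 x : (forall k, ~ F k x) -> forall n, S n x = 0.
    move=> Fx n; rewrite /S big1// => k _.
    by rewrite indicE memNset.
  have S1 x k : F k x -> forall n, S n x = (k < n)%N%:R.
    move=> Fx n; rewrite /S.
    have eqk j : \1_(F j) x = (j == k)%:R :> R.
      rewrite indicE; congr (nat_of_bool _)%:R; apply/idP/idP.
        rewrite inE => Fj; apply/eqP; apply: (tF j k) => //; by exists x.
      by move=> /eqP ->; rewrite inE.
    under eq_bigr do rewrite eqk.
    rewrite -natr_sum; congr _%:R; transitivity (count_mem k (iota 0 n)).
      by rewrite -sum1_count [RHS]big_mkcond.
    by rewrite count_uniq_mem ?iota_uniq// mem_iota.
  apply: (@poly_approximable_lim _ _ S) => [n|n x|x].
  + by apply: poly_approximable_sum.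
  + have [[k Fx]|nF] := pselect (exists k, F k x); last first.
      by rewrite S0 ?normr0// => k Fx; apply: nF; exists k.
    by rewrite (S1 _ _ Fx); case: (_ < _)%N; rewrite ?normr0 ?normr1.
  + have [[k Fx]|nF] := pselect (exists k, F k x); last first.
      have nF' k : ~ F k x by move=> Fx; apply: nF; exists k.
      rewrite indicE memNset => [|[k _]]; last exact: nF'.
      by apply: cvg_near_cst; apply: nearW => n; rewrite S0.
    rewrite indicE mem_set; last by exists k.
    apply: cvg_near_cst; near=> n; rewrite (S1 _ _ Fx).
    by rewrite (_ : (k < n)%N)//; near: n; exact: nbhs_infty_gt.
Unshelve. all: by end_near. Qed.

Lemma nnsfun_approximable (f : {nnsfun (measurableTypeR R) >-> R}) :
  poly_approximable nu f.
Proof.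
rewrite (_ : (f : _ -> _) = fun x => \sum_(y <- finmap.enum_fset (fset_set (range f)))
   y * \1_(f @^-1` [set y]) x); last first.
  by apply/funext => x; rewrite fimfunE fsbig_finite.
apply: poly_approximable_sum => y; apply: poly_approximableZ.
exact: indic_approximable.
Qed.

End measurable_approx.

(** * Gaussian integrals of polynomials *)

(** Serves both expectations of polynomials: under the Gaussian law and in [X]. *)
Lemma linear_integral d (T : measurableType d) (R : realType) (V : lmodType R)
    (mu : {measure set T -> \bar R}) (f : V -> T -> R) :
  (forall a u v t, f (a *: u + v) t = a * f u t + f v t) ->
  (forall v, mu.-integrable setT (EFin \o f v)) ->
  exists L : {linear V -> R | *%R}, forall v, (L v)%:E = (\int[mu]_t (f v t)%:E)%E.
Proof.
move=> flin fint; pose L0 v := \int[mu]_t (f v t).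
have L0lin : GRing.linear_for *%R L0.
  move=> a u v; rewrite /L0.
  under eq_Rintegral do rewrite flin.
  rewrite RintegralD//; last exact: (integrableZl _ a (fint u)).
  by rewrite RintegralZl.
pose L : {linear V -> R | *%R} := HB.pack L0 (GRing.isLinear.Build _ _ _ _ L0 L0lin).
exists L => v; rewrite /L/= /L0 /Rintegral fineK//.
exact: (integrable_fin_num _ (fint v)).
Qed.

(** Change of variables holds for the Radon-Nikodym derivative, and [p] agrees with it almost
    everywhere since both have the same integrals over measurable sets. *)
Lemma integral_density d (T : measurableType d) (R : realType)
    (la : {sigma_finite_measure set T -> \bar R})
    (rho : {finite_measure set T -> \bar R}) (p : T -> R) :
  measurable_fun setT p -> (forall x, 0 <= p x) ->
  (forall A, measurable A -> rho A = \int[la]_(x in A) (p x)%:E)%E ->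
  forall g : T -> \bar R, measurable_fun setT g -> (forall x, 0 <= g x)%E ->
  (\int[rho]_x g x = \int[la]_x (g x * (p x)%:E))%E.
Proof.
move=> mp p0 rhop g mg g0.
have rhola : rho `<< la.
  apply/null_content_dominatesP => A mA laA; rewrite rhop//.
  by apply: null_set_integral => //; apply/measurable_EFinP; exact: measurable_funTS.
rewrite -(Radon_Nikodym_SigmaFinite.change_of_variables rhola)//.
have fint := Radon_Nikodym_SigmaFinite.f_integrable rhola.
have mf := measurable_int la fint.
apply: ge0_ae_eq_integral => //.
- exact: emeasurable_funM.
- by apply: emeasurable_funM => //; exact/measurable_EFinP.
- by move=> x _; rewrite mule_ge0// Radon_Nikodym_SigmaFinite.f_ge0.
- by move=> x _; rewrite mule_ge0// lee_fin.
have : ae_eq la setT (Radon_Nikodym_SigmaFinite.f rho la) (EFin \o p).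
  apply: integral_ae_eq => //; first exact/measurable_EFinP.
  by move=> A _ mA; rewrite -Radon_Nikodym_SigmaFinite.f_integral// rhop.
by apply: filterS => x /[apply] /= ->.
Qed.

Section gaussian_polynomials.
Context {R : realType}.
Local Notation mu := (@lebesgue_measure R).
Local Notation phi := (@normal_pdf R 0 1).

Lemma normal_pdf01E (x : R) : phi x = normal_peak 1 * expR (- (x ^+ 2) / 2).
Proof. by rewrite normal_pdfE ?oner_eq0// /normal_fun subr0 expr1n. Qed.

(** The [k]-th power of [t <= expR t] at [t = y / k]. *)
Lemma expr_le_expR (y : R) k : 0 <= y -> y ^+ k <= k%:R ^+ k * expR y.
Proof.
move=> y0; case: k => [|k]; first by rewrite !expr0 mul1r -expR0 ler_expR.
have -> : expR y = expR (y / k.+1%:R) ^+ k.+1 by rewrite -expRM_natr divfK.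
rewrite -exprMn lerXn2r ?nnegrE ?mulr_ge0 ?expR_ge0//.
rewrite mulrC -ler_pdivrMr//; apply: le_trans (expR_ge1Dx _).
by rewrite lerDr.
Qed.

Lemma poly_gaussian_bound (q : {poly R}) : exists2 K : R, 0 <= K &
  forall x, `|q.[x]| * expR (- (x ^+ 2) / 2) <= K * expR (- (x ^+ 2) / 4).
Proof.
(* Half of the Gaussian exponent absorbs the monomial; [2z <= z^2 + 1] reduces [z = |x|^k] to its
   square, to which [expr_le_expR] applies. *)
have mono k (x : R) : `|x| ^+ k <= (1 + (4 * k%:R) ^+ k) * expR (x ^+ 2 / 4).
  have e1 : 1 <= expR (x ^+ 2 / 4) by rewrite -expR0 ler_expR divr_ge0 ?sqr_ge0.
  have : 0 <= (`|x| ^+ k - 1) ^+ 2 by exact: sqr_ge0.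
  have : `|x| ^+ k * `|x| ^+ k <= (4 * k%:R) ^+ k * expR (x ^+ 2 / 4).
    rewrite -exprMn -expr2 real_normK ?num_real//.
    rewrite {1}(_ : x ^+ 2 = 4 * (x ^+ 2 / 4)); last by field.
    rewrite exprMn [(4 * _) ^+ k]exprMn -[leRHS]mulrA ler_wpM2l ?exprn_ge0//.
    by apply: expr_le_expR; rewrite divr_ge0 ?sqr_ge0.
  move: (`|x| ^+ k) ((4 * k%:R) ^+ k) (expR _) e1 => z c e e1 h1 h2; nra.
exists (\sum_(i < size q) `|q`_i| * (1 + (4 * i%:R) ^+ i)).
  by apply: sumr_ge0 => i _; rewrite mulr_ge0// addr_ge0// exprn_ge0// mulr_ge0.
move=> x; have -> : - x ^+ 2 / 4 = x ^+ 2 / 4 + (- (x ^+ 2) / 2) by field.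
rewrite expRD mulrA ler_wpM2r ?expR_ge0// horner_coef.
apply: le_trans (ler_norm_sum _ _ _) _; rewrite mulr_suml ler_sum// => i _.
by rewrite normrM normrX -mulrA ler_wpM2l.
Qed.

Lemma measurable_poly_normal_pdf (q : {poly R}) :
  measurable_fun (T := measurableTypeR R) setT (fun x => q.[x] * phi x).
Proof.
apply: measurable_funM; first exact: measurable_poly.
exact: measurable_normal_pdf.
Qed.

Lemma integrable_poly_normal_pdf (q : {poly R}) :
  mu.-integrable setT (fun x => (q.[x] * phi x)%:E).
Proof.
have [K K0 qK] := poly_gaussian_bound q.
have s0 : Num.sqrt 2 != 0 :> R by rewrite sqrtr_eq0 -ltNge.
(* Chosen so that [c] times the centred normal density of variance 2 is the bound with
   [expR (- x ^+ 2 / 4)]. *)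
pose c : R := K * normal_peak 1 / normal_peak (Num.sqrt 2).
have int2 := integrableZl measurableT c (integrable_normal_pdf (0 : R) (Num.sqrt 2)).
apply: le_integrable int2 => //.
  by apply/measurable_EFinP; exact: measurable_poly_normal_pdf.
move=> x _; rewrite -EFinM !abse_EFin lee_fin.
rewrite [leLHS]normrM (ger0_norm (normal_pdf_ge0 0 1 x)).
apply: le_trans (ler_norm _); rewrite normal_pdf01E normal_pdfE//= /normal_fun subr0.
rewrite sqr_sqrtr// (_ : 2 *+ 2 = 4 :> R) -?mulrnA// mulrCA.
have -> : c * (normal_peak (Num.sqrt 2) * expR (- x ^+ 2 / 4)) =
    normal_peak 1 * (K * expR (- x ^+ 2 / 4)).
  by rewrite /c mulrA divfK ?gt_eqF ?normal_peak_gt0//; ring.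
by rewrite ler_wpM2l ?normal_peak_ge0.
Qed.

(** Boundary terms for integration by parts, with [u n] equal to [n] or [- n]; [n <= n ^ 2] reduces
    the decay to a geometric one. *)
Lemma poly_gaussian_cvg0 (q : {poly R}) (u : nat -> R) :
  (forall n, `|u n| = n%:R) ->
  (fun n => q.[u n] * expR (- (u n ^+ 2) / 2)) @ \oo --> 0.
Proof.
move=> un; have [K K0 qK] := poly_gaussian_bound q.
have cvgK : (fun n => K * expR (- 4^-1) ^+ n) @ \oo --> 0.
  rewrite -[X in _ --> X](mulr0 K); apply: cvgM; first exact: cvg_cst.
  by apply: cvg_expr; rewrite ger0_norm ?expR_ge0// expR_lt1 oppr_lt0.
apply: norm_cvg0; apply: (squeeze_cvgr _ (cvg_cst 0) cvgK); apply: nearW => n.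
rewrite normr_ge0/= normrM [X in _ * X]ger0_norm ?expR_ge0// (le_trans (qK _))//.
rewrite ler_wpM2l// -expRM_natr ler_expR -real_normK ?num_real// un.
rewrite mulNr mulNr lerN2 mulrC ler_wpM2r// expr2.
by case: n => [|n]; [rewrite mul0r|rewrite ler_peMl// ler1n].
Qed.

(** The integrand is the derivative of [q] times the density: integrate over growing symmetric
    intervals and let the boundary terms vanish. *)
Lemma integral_gaussian_derivative (q : {poly R}) :
  (\int[mu]_x ((q^`() - 'X * q).[x] * phi x)%:E = 0)%E.
Proof.
pose w (x : R) := expR (- (x ^+ 2) / 2).
pose F (x : R) : R := normal_peak 1 * (q.[x] * w x).
pose f (x : R) : R := (q^`() - 'X * q).[x] * phi x.
have dF (x : R) : is_derive x (1 : R) F (f x).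
  rewrite /F /f normal_pdf01E; apply: is_derive_eq.
  by rewrite !hornerE /GRing.scale /= /w; field.
have F'E : derive1 F = f.
  by apply/funext => x; rewrite derive1E; apply: derive_val.
have cF : continuous F.
  move=> x; apply/differentiable_continuous/derivable1_diffP.
  by have [] := dF x.
have cf : continuous f.
  move=> x; apply: cvgM; first exact: continuous_horner.
  by apply: continuous_normal_pdf; rewrite oner_eq0.
have FTC n : (\int[mu]_(x in `[(- n.+1%:R)%R, n.+1%:R]) (f x)%:E =
    (F n.+1%:R)%:E - (F (- n.+1%:R)%R)%:E)%E.
  apply: continuous_FTC2 => //.
  - by rewrite -subr_gt0 opprK -natrD.
  - by apply: continuous_subspaceT.
  - split.
    + by move=> x _; have [] := dF x.
    + exact/cvg_at_right_filter/cF.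
    + exact/cvg_at_left_filter/cF.
  - by move=> x _; rewrite F'E.
have intf := integrable_poly_normal_pdf (q^`() - 'X * q).
pose g n (x : measurableTypeR R) := ((fun x => (f x)%:E) \_ `[(- n.+1%:R)%R, n.+1%:R]) x.
have lim1 : (fun n => \int[mu]_x (g n x))%E @ \oo --> (\int[mu]_x (f x)%:E)%E.
  have [] // := @dominated_convergence _ _ _ mu setT measurableT g
    (fun x => (f x)%:E) (fun x => `|(f x)%:E|)%E.
  - move=> n; apply/measurable_restrict => //; rewrite setTI.
    by apply: measurable_funTS; exact: measurable_int intf.
  - exact: measurable_int intf.
  - apply: aeW => x _; apply: cvg_near_cst; near=> n.
    rewrite /g patchE mem_set//= in_itv/= -ler_norml.
    have : `|x| < n%:R by near: n; exact: nbhs_infty_gtr.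
    by move=> /ltW/le_trans; apply; rewrite ler_nat.
  - exact: integrable_abse.
  - apply: aeW => x n _; rewrite /g patchE; case: ifP => // _.
    by rewrite abse0.
have lim2 : (fun n => \int[mu]_x (g n x))%E @ \oo --> 0%E.
  rewrite (_ : (fun n => _) = fun n => (F n.+1%:R - F (- n.+1%:R))%:E); last first.
    by apply/funext => n; rewrite EFinB -FTC [RHS]integral_mkcond.
  apply: cvg_EFin; first exact: nearW.
  have lims (u : nat -> R) : (forall n, `|u n| = n%:R) ->
      (fun n => F (u n.+1)) @ \oo --> 0.
    move=> un; rewrite -[X in _ --> X](mulr0 (normal_peak 1)).
    apply: cvgM; first exact: cvg_cst.
    by have := poly_gaussian_cvg0 q un;
      rewrite -(cvg_shiftS (fun n => q.[u n] * w (u n))).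
  rewrite -[X in _ --> X](subr0 0); apply: cvgB.
    by apply: (lims (fun n => n%:R)) => n; rewrite normr_nat.
  by apply: (lims (fun n => - n%:R)) => n; rewrite normrN normr_nat.
by rewrite -(cvg_lim _ lim1)// (cvg_lim _ lim2).
Unshelve. all: by end_near. Qed.

Lemma gaussian_functional : exists L : {linear {poly R} -> R | *%R},
  [/\ forall q, (L q)%:E = (\int[mu]_x (q.[x] * phi x)%:E)%E,
      L 1 = 1, forall q, L ('X * q) = L q^`() & forall q, 0 <= L (q ^+ 2)].
Proof.
have [L LE] : exists L : {linear {poly R} -> R | *%R},
    forall q, (L q)%:E = (\int[mu]_x (q.[x] * phi x)%:E)%E.
  apply: linear_integral => [a p q x|q]; last exact: integrable_poly_normal_pdf.
  by rewrite hornerD hornerZ; ring.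
exists L; split=> // [|q|q].
- apply: EFin_inj; rewrite LE.
  by under eq_integral do rewrite hornerE mul1r; rewrite integral_normal_pdf.
- apply/eqP; rewrite eq_sym -subr_eq0 -linearB /=; apply/eqP/EFin_inj.
  by rewrite LE integral_gaussian_derivative.
- rewrite -lee_fin LE; apply: integral_ge0 => x _.
  by rewrite lee_fin mulr_ge0 ?normal_pdf_ge0// horner_exp sqr_ge0.
Qed.

End gaussian_polynomials.

(** * Laws dominated by the Gaussian law *)

(** Jensen's inequality for the square, by integrating the tangent bound
    [2 * c * h - c ^+ 2 <= h ^+ 2]. *)
Lemma sqr_integral_le d (T : measurableType d) (R : realType)
    (rho : probability T R) (h : T -> R) (c : R) :
  rho.-integrable setT (EFin \o h) -> (\int[rho]_x (h x)%:E = c%:E)%E ->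
  ((c ^+ 2)%:E <= sqint rho h)%E.
Proof.
move=> ih hc; have mh : measurable_fun setT h.
  by apply/measurable_EFinP; exact: measurable_int ih.
have [->|fin] := eqVneq (sqint rho h) +oo%E; first by rewrite leey.
have ih2 : rho.-integrable setT (fun x => ((h x) ^+ 2)%:E).
  apply/integrableP; split; first exact: measurable_sqr_EFin.
  under eq_integral do rewrite gee0_abs ?lee_fin ?sqr_ge0//.
  by rewrite ltey.
have i1 := integrableZl measurableT (2 * c) ih.
have i2 : rho.-integrable setT (cst (c ^+ 2)%:E) by exact: finite_measure_integrable_cst.
have -> : ((c ^+ 2)%:E = \int[rho]_x ((2 * c)%:E * (h x)%:E - (c ^+ 2)%:E))%E.
  rewrite integralB//= integralZl//= hc integral_cst//= probability_setT mule1.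
  by rewrite -EFinM -EFinB; congr EFin; ring.
apply: le_integral => //; first exact: integrableB.
move=> x _; rewrite -EFinM -EFinB lee_fin.
by have := sqr_ge0 (h x - c); rewrite sqrrB; lra.
Qed.

Lemma integrable_nnsfun d (T : measurableType d) (R : realType)
    (rho : {finite_measure set T -> \bar R}) (g : {nnsfun T >-> R}) :
  rho.-integrable setT (EFin \o g).
Proof.
apply: measurable_bounded_integrable => //; first exact: fin_num_fun_lty.
have [M [_ gM]] := simple_bounded g.
by exists M; split=> [|x Mx y _]; [exact: num_real|exact: gM].
Qed.

Lemma integrable_sqr_nnsfun d (T : measurableType d) (R : realType)
    (rho : {finite_measure set T -> \bar R}) (g : {nnsfun T >-> R}) :
  rho.-integrable setT (fun x => ((g x) ^+ 2)%:E).
Proof.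
have mg2 : measurable_fun setT (fun x => g x ^+ 2) by exact: measurable_funX.
apply: (measurable_bounded_integrable measurableT _ mg2).
  exact: fin_num_fun_lty.
have [M [_ gM]] := simple_bounded g.
exists ((M + 1) ^+ 2); split=> [|x Mx y _]; first exact: num_real.
apply: le_trans (ltW Mx); rewrite /= normrX ger0_norm//.
have := gM (M + 1); rewrite ltrDl ltr01 => /(_ isT y I) /=.
by rewrite ger0_norm// => gy; rewrite lerXn2r ?nnegrE// (le_trans _ gy).
Qed.

(** Under the sum measure, a single polynomial approximates for both laws at once. *)
Lemma finite_measure_add d (T : measurableType d) (R : realType)
    (m1 m2 : {finite_measure set T -> \bar R}) :
  exists nu : {finite_measure set T -> \bar R}, forall g : T -> R,
    measurable_fun setT g -> (sqint nu g = sqint m1 g + sqint m2 g)%E.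
Proof.
pose nu0 := measure_add m1 m2.
have nu0fin : fin_num_fun nu0.
  by move=> A mA; rewrite /nu0 measure_addE fin_numD !fin_num_measure.
pose nu : {finite_measure set T -> \bar R} :=
  HB.pack (nu0 : set T -> \bar R) (Measure.on nu0)
    (Measure_isFinite.Build _ _ _ nu0 nu0fin).
exists nu => g mg; apply: (ge0_integral_measure_add m1 m2 measurableT).
  by move=> x _; rewrite lee_fin sqr_ge0.
exact: measurable_sqr_EFin.
Qed.

Section gaussian_domination.
Context {R : realType}.
Local Notation mu := (@lebesgue_measure R).
Local Notation phi := (@normal_pdf R 0 1).
Local Notation gamma := (@normal_prob R 0 1).
Variables (L : {linear {poly R} -> R | *%R}).
Hypothesis LE : forall q, (L q)%:E = (\int[mu]_x (q.[x] * phi x)%:E)%E.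
Hypotheses (L1 : L 1 = 1) (LX : forall q, L ('X * q) = L q^`()).

Variables (rho : probability (measurableTypeR R) R).
Variables (M : {linear {poly R} -> R | *%R}) (C : R).
Hypothesis rho_int : forall q, rho.-integrable setT (fun x => (q.[x])%:E).
Hypothesis ME : forall q, (M q)%:E = (\int[rho]_x (q.[x])%:E)%E.
Hypothesis C0 : 0 <= C.
Hypothesis MC : forall q, M q ^+ 2 <= C * L (q ^+ 2).

Lemma integral_normal_prob (g : measurableTypeR R -> \bar R) :
  measurable_fun setT g -> (forall x, 0 <= g x)%E ->
  (\int[gamma]_x g x = \int[mu]_x (g x * (phi x)%:E))%E.
Proof.
apply: integral_density => //; first exact: measurable_normal_pdf.
by move=> x; exact: normal_pdf_ge0.
Qed.

Lemma sqint_normal_prob (g : measurableTypeR R -> R) : measurable_fun setT g ->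
  (sqint gamma g = \int[mu]_x (g x ^+ 2 * phi x)%:E)%E.
Proof.
move=> mg; rewrite /sqint integral_normal_prob//; first exact: measurable_sqr_EFin.
by move=> x; rewrite lee_fin sqr_ge0.
Qed.

Lemma sqint_poly_normal_prob q : sqint gamma (fun x => q.[x]) = (L (q ^+ 2))%:E.
Proof.
rewrite sqint_normal_prob; last exact: measurable_poly.
by rewrite LE; apply: eq_integral => x _; rewrite horner_exp.
Qed.

Lemma sqint_poly_rho q : sqint rho (fun x => q.[x]) = (M (q ^+ 2))%:E.
Proof. by rewrite ME; apply: eq_integral => x _; rewrite horner_exp. Qed.

Variable nu : {finite_measure set (measurableTypeR R) -> \bar R}.
Hypothesis nuE : forall g : measurableTypeR R -> R, measurable_fun setT g ->
  (sqint nu g = sqint rho g + sqint gamma g)%E.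

(** Both laws have moments of order [2N] of size [4^N N!], against [N!^2] in the squared remainder:
    what is left is a term of an exponential series. *)
Lemma trig_remainder_small (a e : R) : 0 < e -> exists N,
  (sqint nu (fun x => (a * x) ^+ N / N`!%:R)%R <= e%:E)%E.
Proof.
move=> e0.
(* [MC] at ['X^(2 * N)] bounds the square of this moment; [C <= (C + 1)^2] avoids a square root of
   [C]. *)
have Mle N : M 'X^(2 * N) <= (C + 1) * (4 ^+ N * N`!%:R).
  have B0 : 0 <= 4 ^+ N * N`!%:R :> R by rewrite mulr_ge0// exprn_ge0.
  have := MC 'X^(2 * N); rewrite -exprM mulnAC => h.
  have := functional_moment_mul4 L1 LX N => h4.
  have {h4}h := le_trans h (ler_wpM2l C0 h4).
  rewrite -[leLHS]ger0_norm; last first.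
    rewrite -lee_fin ME; apply: integral_ge0 => x _.
    by rewrite lee_fin hornerXn exprM exprn_ge0// sqr_ge0.
  rewrite -(@ler_pXn2r _ 2)// ?nnegrE ?mulr_ge0 ?addr_ge0// real_normK ?num_real//.
  apply: le_trans h _; rewrite [leRHS]exprMn ler_wpM2r ?sqr_ge0//.
  have := sqr_ge0 C; nra.
have cvg0 : (fun N => (C + 2) * exp_coeff (4 * a ^+ 2) N) @ \oo --> 0.
  rewrite -[X in _ --> X](mulr0 (C + 2)); apply: cvgM; first exact: cvg_cst.
  exact: cvg_exp_coeff.
have [N _ /(_ N (leqnn N))/= small] := cvgr_le _ cvg0 _ e0.
exists N; pose q : {poly R} := (a ^+ N / N`!%:R) *: 'X^N.
have qE : (fun x => (a * x) ^+ N / N`!%:R) = (fun x : measurableTypeR R => q.[x]).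
  by apply/funext => x; rewrite /q hornerZ hornerXn exprMn mulrAC.
rewrite qE nuE; last exact: measurable_poly.
rewrite sqint_poly_rho sqint_poly_normal_prob -EFinD lee_fin.
have -> : q ^+ 2 = ((a ^+ N / N`!%:R) ^+ 2) *: 'X^(2 * N).
  by rewrite /q exprZn -exprM mulnC.
rewrite !linearZ /=; apply: le_trans small.
have /andP[_ Lle] := functional_even_moment L1 LX N.
rewrite -mulrDr; apply: le_trans (ler_wpM2l (sqr_ge0 _) (lerD (Mle N) Lle)) _.
have -> : exp_coeff (4 * a ^+ 2) N = 4 ^+ N * (a ^+ N) ^+ 2 / N`!%:R.
  by rewrite /exp_coeff /= exprMn -!exprM mulnC.
have F0 : N`!%:R != 0 :> R by rewrite pnatr_eq0 -lt0n fact_gt0.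
rewrite le_eqVlt; apply/orP; left; apply/eqP.
by move: (a ^+ _) (4 ^+ _) => y z; field.
Qed.

(** Passage to the limit from polynomials. The 4 is made of two factors 2: one from [sqintD], one
    from [c^2 <= 2 (M q)^2 + 2 (c - M q)^2]. *)
Lemma sqr_integral_nnsfun_le (g : {nnsfun (measurableTypeR R) >-> R}) (c : R) :
  (\int[rho]_x (g x)%:E = c%:E)%E ->
  ((c ^+ 2)%:E <= (4 * C)%:E * sqint gamma g)%E.
Proof.
move=> gc; have mg : measurable_fun setT g by exact: measurable_funPT.
have ig := integrable_sqr_nnsfun gamma g.
have : sqint gamma g \is a fin_num by exact: integrable_fin_num.
move=> /fineK; set B := fine _ => BE; rewrite -BE -EFinM lee_fin.
apply/ler_addgt0Pr => e e0.
(* An approximation error [z] contributes [4 * C * z] through [L (q ^+ 2)] and [2 * z] through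
   [c - M q]. *)
have e4 : 0 < e / (4 * C + 2) by rewrite divr_gt0// ltr_wpDl// mulr_ge0.
have [_ /(_ _ e4)[q]] :=
  nnsfun_approximable (trig_poly_approximable trig_remainder_small) g.
have mq : measurable_fun setT (fun x : measurableTypeR R => q.[x]).
  exact: measurable_poly.
rewrite nuE; last exact: measurable_funB.
move=> gq.
have gq1 : (sqint rho (fun x => g x - q.[x])%R <= (e / (4 * C + 2))%:E)%E.
  by apply: le_trans gq; rewrite leeDl// sqint_ge0.
have gq2 : (sqint gamma (fun x => g x - q.[x])%R <= (e / (4 * C + 2))%:E)%E.
  by apply: le_trans gq; rewrite leeDr// sqint_ge0.
have dist : (c - M q) ^+ 2 <= e / (4 * C + 2).
  rewrite -lee_fin; apply: le_trans gq1; apply: sqr_integral_le.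
    exact: (integrableB measurableT (integrable_nnsfun rho g) (rho_int q)).
  rewrite EFinB ME -gc -integralB//; exact: integrable_nnsfun.
have Lq : L (q ^+ 2) <= 2 * B + 2 * (e / (4 * C + 2)).
  rewrite -lee_fin EFinD !EFinM BE -sqint_poly_normal_prob.
  have -> : (fun x : measurableTypeR R => q.[x]) = fun x => g x + -1 * (g x - q.[x]).
    by apply/funext => x; ring.
  have mgq : measurable_fun setT (fun x => g x - q.[x]) by exact: measurable_funB.
  apply: le_trans (sqintD _ mg _) _; first exact: measurable_funM.
  by rewrite sqintZ// expr2 mulN1r opprK mul1e leeD2l// lee_wpmul2l.
have h := MC q; have h2 := ler_wpM2l C0 Lq.
have eE : e = (4 * C + 2) * (e / (4 * C + 2)).
  by rewrite mulrC divfK// gt_eqF// ltr_wpDl// mulr_ge0.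
rewrite [in leRHS]eE; move: (e / (4 * C + 2)) dist h2 => z dist h2.
by have := sqr_ge0 (c - 2 * M q); nra.
Qed.

Lemma gaussian_dominates : rho `<< mu.
Proof.
apply/null_content_dominatesP => A mA muA.
have gA : gamma A = 0%E.
  by have /null_content_dominatesP := normal_prob_dominates (0 : R) 1; apply.
have rA : rho A = (fine (rho A))%:E by rewrite fineK// fin_num_measure.
have := @sqr_integral_nnsfun_le (indic_nnsfun R mA) (fine (rho A)).
rewrite /= integral_indic// setIT => /(_ rA).
have -> : sqint gamma (\1_A : _ -> R) = gamma A.
  have := integral_indic gamma measurableT mA; rewrite setIT => <-.
  apply: eq_integral => x _.
  by rewrite indicE; case: (_ \in _); rewrite ?expr1n ?expr0n.
rewrite gA mule0 lee_fin => h; rewrite rA.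
by have /eqP := le_anti (introT andP (conj h (sqr_ge0 _))); rewrite sqrf_eq0 => /eqP->.
Qed.

Lemma gaussian_density_sqr_integrable (p : measurableTypeR R -> R) :
  measurable_fun setT p -> (forall x, 0 <= p x) ->
  (forall A, measurable A -> rho A = \int[mu]_(x in A) (p x)%:E)%E ->
  (\int[mu]_x (p x ^+ 2 / phi x)%:E < +oo)%E.
Proof.
move=> mp p0 rhop.
have phi0 x : 0 < phi x.
  by rewrite normal_pdf01E mulr_gt0 ?expR_gt0// normal_peak_gt0 ?oner_eq0.
(* The density of [rho] with respect to [gamma]; the integral to bound is its squared norm under
   [gamma]. *)
pose h x := p x / phi x.
have mphi : measurable_fun (T := measurableTypeR R) setT phi.
  exact: measurable_normal_pdf.
have mphiV : measurable_fun [set: R] (fun x : R => (phi x)^-1).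
  apply: continuous_measurable_fun => x; apply: cvgV; first by rewrite gt_eqF.
  by apply: continuous_normal_pdf; rewrite oner_eq0.
have mh : measurable_fun setT h by exact: (measurable_funM mp mphiV).
have mhE : measurable_fun setT (EFin \o h) by exact/measurable_EFinP.
have h0 x : 0 <= h x by rewrite divr_ge0// ltW.
pose g := nnsfun_approx measurableT mhE.
have gcvg x : g ^~ x @ \oo --> h x.
  have := @cvg_nnsfun_approx _ _ _ _ measurableT _ mhE (fun x _ => h0 x) x I.
  by move=> /fine_cvgP[].
have gnd x : {homo (fun n => g n x) : n m / (n <= m)%N >-> n <= m}.
  by move=> n m nm; have /lefP := nd_nnsfun_approx measurableT mhE nm; apply.
have gh n x : g n x <= h x.
  rewrite -(cvg_lim _ (gcvg x))//; apply: nondecreasing_cvgn_le; first exact: gnd.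
  by apply/cvg_ex; exists (h x); exact: gcvg.
have mg n : measurable_fun setT (g n) by exact: measurable_funPT.
have sg n : (sqint gamma (g n) <= (4 * C)%:E)%E.
  have Ic : (\int[rho]_x (g n x)%:E)%E \is a fin_num.
    by apply: integrable_fin_num => //; exact: integrable_nnsfun.
  move: Ic => /fineK; set c := fine _ => /esym gc.
  (* Since [g n <= h], the integral of [g n ^+ 2] under [gamma] is at most that of [g n * h], which
     is that of [g n] under [rho]. *)
  have Sc : (sqint gamma (g n) <= c%:E)%E.
    have mgE : measurable_fun setT (EFin \o g n) by exact/measurable_EFinP.
    have gE0 x : (0 <= (EFin \o g n) x)%E by rewrite lee_fin.
    rewrite -gc (integral_density mp p0 rhop mgE gE0).
    rewrite sqint_normal_prob//; apply: ge0_le_integral => //.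
    - by move=> x _; rewrite lee_fin mulr_ge0 ?sqr_ge0// ltW.
    - by apply/measurable_EFinP; apply: measurable_funM => //; exact: measurable_funX.
    - have mpE : measurable_fun setT (EFin \o p) by exact/measurable_EFinP.
      exact: (emeasurable_funM mgE mpE).
    - move=> x _; rewrite -EFinM lee_fin expr2 -mulrA ler_wpM2l//.
      by rewrite -ler_pdivlMr//; exact: gh.
  apply: (le_trans Sc); rewrite lee_fin.
  have c0 : 0 <= c by rewrite -lee_fin -gc integral_ge0// => x _; rewrite lee_fin.
  (* The bound improves itself: [c^2 <= 4 C c] with [c] finite forces [c <= 4 C]. *)
  have [//|cC] := lerP c (4 * C).
  have : ((c ^+ 2)%:E <= (4 * C * c)%:E)%E.
    apply: le_trans (sqr_integral_nnsfun_le gc) _.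
    by rewrite (EFinM (4 * C) c) lee_wpmul2l// lee_fin mulr_ge0.
  have cp : 0 < c by apply: le_lt_trans cC; rewrite mulr_ge0.
  have : 0 < c * (c - 4 * C) by rewrite mulr_gt0// subr_gt0.
  by rewrite lee_fin; nra.
have -> : (\int[mu]_x (p x ^+ 2 / phi x)%:E = sqint gamma h)%E.
  rewrite sqint_normal_prob//; apply: eq_integral => x _; congr EFin.
  by rewrite /h; field; rewrite gt_eqF.
apply: le_lt_trans (ltry (4 * C)).
have cvgI : (fun n => sqint gamma (g n)) @ \oo --> sqint gamma h.
  have -> : sqint gamma h = (\int[gamma]_x limn (fun n => (g n x ^+ 2)%:E))%E.
    apply: eq_integral => x _; apply/esym/cvg_lim => //.
    by apply: cvg_EFin; [exact: nearW|exact: (cvgM (gcvg x) (gcvg x))].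
  apply: cvg_monotone_convergence => //.
  - by move=> n; exact: measurable_sqr_EFin.
  - by move=> n x _; rewrite lee_fin sqr_ge0.
  - by move=> x _ n m nm; rewrite lee_fin lerXn2r ?nnegrE//; exact: gnd.
by apply: (cvge_to_le cvgI); apply: nearW => n.
Qed.

End gaussian_domination.

(** * From the Hermite series of X to its density *)

Theorem proposition8p3 (R : realType) (d : measure_display)
    (T : measurableType d) (P : probability T R) (X : {RV P >-> R})
    (moments : forall n : nat,
       P.-integrable [set: T] (fun t => ((X t) ^+ n)%:E))
    (series_cvg : cvgn (fun n : nat =>
       \sum_(1 <= k < n)
          (k`!%:R)^-1 * (fine ('E_P[fun t => hermite k (X t)])) ^+ 2 : R)) :
  distribution P X `<< lebesgue_measure /\
  exists p : R -> R, is_density X p /\ (chi2_normal p < +oo)%E.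
Proof.
have mXR : measurable_fun [set: T] X by exact: measurable_funPT.
have mX : measurable_fun (U := measurableTypeR R) setT X by exact: mXR.
(* [Y] is [X] seen with values in [measurableTypeR R], the measurable type
   carrying [lebesgue_measure], whose display differs from that of [R]. *)
pose Y : {mfun T >-> measurableTypeR R} :=
  HB.pack (X : T -> measurableTypeR R) (isMeasurableFun.Build _ _ _ _ _ mX).
pose rho : probability (measurableTypeR R) R := distribution P Y.
have polyP (q : {poly R}) : P.-integrable setT (EFin \o (fun t => q.[X t])).
  rewrite (_ : EFin \o _ = fun t => (\sum_(i < size q) (q`_i)%:E * (X t ^+ i)%:E)%E).
    by apply: integrable_sum => // i _; exact: integrableZl.
  by apply/funext => t /=; rewrite horner_coef -sumEFin.
have [M ME] : exists M : {linear {poly R} -> R | *%R},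
    forall q, (M q)%:E = (\int[P]_t (q.[X t])%:E)%E.
  apply: linear_integral => // a p q t.
  by rewrite hornerD hornerZ.
have [L [LE L1 LX L0]] := @gaussian_functional R.
have rho_int (q : {poly R}) : rho.-integrable setT (fun x => (q.[x])%:E).
  have mq : measurable_fun (T := measurableTypeR R) setT (fun x => q.[x]).
    exact: measurable_poly.
  apply/integrableP; split; first exact/measurable_EFinP.
  rewrite ge0_integral_distribution//; last first.
    by apply: measurableT_comp => //; exact/measurable_EFinP.
  by have /integrableP[] := polyP q.
have MrhoE q : (M q)%:E = (\int[rho]_x (q.[x])%:E)%E.
  rewrite ME integral_distribution//; last exact: polyP.
  by apply/measurable_EFinP; exact: measurable_poly.
pose s n := \sum_(1 <= k < n) (k`!%:R)^-1 * (M (hermite_poly R k)) ^+ 2.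
have sE : s = fun n => \sum_(1 <= k < n)
    (k`!%:R)^-1 * (fine ('E_P[fun t => hermite k (X t)])) ^+ 2.
  apply/funext => n; apply: eq_bigr => k _; congr (_ * _ ^+ 2).
  rewrite unlock; under eq_integral do rewrite hermite_polyE.
  by rewrite -ME.
have s_nd : {homo s : n m / (n <= m)%N >-> n <= m}.
  apply/nondecreasing_seqP => n; rewrite /s.
  case: n => [|n]; first by rewrite !big_geq.
  by rewrite [leRHS]big_nat_recr//= lerDl mulr_ge0 ?sqr_ge0// invr_ge0.
have s_le n : s n <= limn s.
  by apply: nondecreasing_cvgn_le => //; rewrite sE.
(* The 1 is the term of index 0, equal to [M 1 ^+ 2], which the series starting at 1 leaves out. *)
have C0 : 0 <= 1 + limn s by have := s_le 0%N; rewrite {1}/s big_geq//; lra.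
have MC q : M q ^+ 2 <= (1 + limn s) * L (q ^+ 2).
  apply: (functional_bound L1 LX L0) => -[|n]; first by rewrite big_ord0.
  rewrite -(big_mkord xpredT (fun k => (k`!%:R)^-1 * M (hermite_poly R k) ^+ 2)).
  rewrite big_ltn// lerD//; last exact: (s_le n.+1).
  have -> : M (hermite_poly R 0) = 1.
    apply: EFin_inj; rewrite ME; under eq_integral do rewrite hornerE.
    by rewrite integral_cst//= probability_setT mule1.
  by rewrite fact0 invr1 expr1n mulr1.
have [nu nuE] := finite_measure_add rho (normal_prob 0 1).
have dom : rho `<< lebesgue_measure.
  exact: (gaussian_dominates LE L1 LX rho_int MrhoE C0 MC nuE).
split; first exact: dom.
have [f [f0 ffin fint fE]] := radon_nikodym_sigma_finite dom.
(* The Radon-Nikodym derivative takes extended values, all finite, so [fine] loses nothing. *)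
have mf : measurable_fun setT (fun x => fine (f x)).
  by apply: measurableT_comp => //; exact: measurable_int fint.
have rhof A : measurable A -> rho A = (\int[lebesgue_measure]_(x in A) (fine (f x))%:E)%E.
  by move=> mA; rewrite fE//; apply: eq_integral => x _; rewrite fineK.
exists (fun x => fine (f x)); split.
  split; [exact: mf|by move=> x; exact: fine_ge0|exact: rhof].
have fin : (\int[lebesgue_measure]_x (fine (f x) ^+ 2 / normal_pdf 0 1 x)%:E < +oo)%E.
  apply: (gaussian_density_sqr_integrable LE L1 LX rho_int MrhoE C0 MC nuE mf _ rhof).
  by move=> x; exact: fine_ge0.
by rewrite /chi2_normal lteBlDr// addye.
Qed.
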